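(* For every integer $n\ge0$, the number of walks on $\mathbb{N}^2$ starting and ending at $(0,0)$ and consisting of $2n$ steps taken from $\{(-1,-1),(-1,1),(1,-1),(1,1)\}$ is given by the squared Catalan number $c_n^2$. Moreover, the squared Catalan numbers satisfy the following relation with multinomial coefficients: $$c_n^2=\sum_{k=0}^{n}(k,k,n-k,n-k)!+\sum_{k=0}^{n-1}(k,k+2,n-k-1,n-k-1)!-2\sum_{k=0}^{n-1}(k,k+1,n-k-1,n-k)!.$$
   Context: $\mathbb{N}=\{0,1,2,\ldots\}$; a walk on $\mathbb{N}^2$ is a walk all of whose vertices lie in $\mathbb{N}^2$. $c_n=\frac{1}{n+1}\binom{2n}{n}$ is the $n$-th Catalan number. For non-negative integers $m_1,m_2,m_3,m_4$, the multinomial coefficient is denoted $(m_1,m_2,m_3,m_4)!=\dfrac{(m_1+m_2+m_3+m_4)!}{m_1!\,m_2!\,m_3!\,m_4!}$. *)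

(* Defs.v *)
From mathcomp Require Import all_boot all_order all_algebra.
Set Implicit Arguments.
Unset Strict Implicit.
Unset Printing Implicit Defensive.
Import Order.TTheory GRing.Theory Num.Theory.

(* [catalan] and [multinomial4] use the Euclidean quotient on nat; [catalanK]
   and [multinomial4K] show that both divisions are exact. *)
Definition catalan (n : nat) : nat := 'C(2 * n, n) %/ n.+1.

Definition multinomial4 (m1 m2 m3 m4 : nat) : nat :=
  (m1 + m2 + m3 + m4)`! %/ (m1`! * m2`! * m3`! * m4`!).

Lemma catalanK n : catalan n * n.+1 = 'C(2 * n, n).
Proof.
rewrite /catalan divnK //.
have h : n.+1 * 'C(2 * n, n.+1) = n * 'C(2 * n, n).
  by rewrite mul_bin_left mul2n -addnn addnK.
have -> : 'C(2 * n, n) = n.+1 * 'C(2 * n, n) - n.+1 * 'C(2 * n, n.+1).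
  by rewrite h mulSn addnK.
by rewrite dvdn_sub // dvdn_mulr.
Qed.

Lemma multinomial4K m1 m2 m3 m4 :
  multinomial4 m1 m2 m3 m4 * (m1`! * m2`! * m3`! * m4`!)
  = (m1 + m2 + m3 + m4)`!.
Proof.
have fact_dvd a b : a`! * b`! %| (a + b)`!.
  have h := bin_fact (leq_addr b a); rewrite addKn in h.
  by rewrite -h dvdn_mull.
rewrite /multinomial4 divnK //.
apply: dvdn_trans (fact_dvd _ _); rewrite dvdn_mul //.
by apply: dvdn_trans (fact_dvd _ _); rewrite dvdn_mul.
Qed.

Local Open Scope ring_scope.

Definition diagonal_steps : seq (int * int) :=
  [:: (-1, -1); (-1, 1); (1, -1); (1, 1)].

Definition in_quadrant (p : int * int) : bool := (0 <= p.1) && (0 <= p.2).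

(* The vertices, starting point included, of the walk that starts at x and
   whose successive steps are the members of s. *)
Definition walk_vertices (x : int * int) (s : seq (int * int)) :
  seq (int * int) := x :: scanl +%R x s.

(* Given its starting point, a walk is determined by its sequence of steps; the
   walks of length m from x to y are thus encoded as m-tuples over the finite
   type [seq_sub S] of the elements of the step set S. *)
Definition quadrant_walks (S : seq (int * int)) (m : nat) (x y : int * int) :
  {set m.-tuple (seq_sub S)} :=
  [set w : m.-tuple (seq_sub S) |
    let v := walk_vertices x [seq val s | s <- w] in
    all in_quadrant v && (last x v == y)].

(* Main.v *)
Require Import Defs.
From mathcomp Require Import all_boot all_order all_algebra.
From mathcomp Require Import zify ring.
Import Order.TTheory GRing.Theory.
Local Open Scope ring_scope.

(** Along a diagonal walk the two coordinates perform independent [±1] walks,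
    so the number of quadrant walks is the product of two numbers of walks on
    the half-line, each of which is a difference of two binomial coefficients
    by the reflection principle: [c_n = 'C(2n, n) - 'C(2n, n+1)]. Expanding the
    square of this difference and applying Vandermonde's convolution to each
    product of binomial coefficients gives the multinomial sums. *)

(** Here [a] is the start and 0 the end of a walk with [m] steps, each 1 or -1. Recursing on the
    first step matches [card_quadrant_walksS]. *)
Fixpoint halfline_walks (m : nat) (a : int) : nat :=
  if a < 0 then 0%N else
  if m is m'.+1 then (halfline_walks m' (a - 1) + halfline_walks m' (a + 1))%N
  else (a == 0 : nat).

Fixpoint line_walks (m : nat) (a : int) : nat :=
  if m is m'.+1 then (line_walks m' (a - 1) + line_walks m' (a + 1))%N
  else (a == 0 : nat).

Lemma line_walksN m a : line_walks m (- a) = line_walks m a.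
Proof.
elim: m a => [|m IHm] a /=; first by rewrite oppr_eq0.
by rewrite -opprD (_ : - a + 1 = - (a - 1)) ?IHm 1?addnC //; ring.
Qed.

Lemma line_walks_gt m a : m%:Z < a -> line_walks m a = 0%N.
Proof.
elim: m a => [|m IHm] a /= ha; first by case: eqP => // a0; lia.
by rewrite !IHm //; lia.
Qed.

(** [k] counts the steps +1: a walk to 0 with [k] of them and [m - k] steps -1 starts at
    [m - 2k]. *)
Lemma line_walks_bin m k : line_walks m (m%:Z - 2 * k%:Z) = 'C(m, k).
Proof.
elim: m k => [|m IHm] [|k] //=.
  rewrite (_ : _ - 1 = m%:Z - 2 * 0%:Z); last lia.
  (* For [k = 0] the neighbour [m + 2] is too far from 0 for [m] steps. *)
  by rewrite IHm [line_walks _ _]line_walks_gt ?bin0 //; lia.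
rewrite (_ : _ - 1 = m%:Z - 2 * k.+1%:Z); last lia.
by rewrite (_ : _ + 1 = m%:Z - 2 * k%:Z) ?IHm ?binS //; lia.
Qed.

(* At [a = -1] the half-line term is zero and the line terms agree by symmetry;
   the induction step from [a = 0] needs this boundary case. *)
Lemma halfline_walks_reflection m (a : int) : -1 <= a ->
  (halfline_walks m a + line_walks m (a + 2))%N = line_walks m a.
Proof.
elim: m a => [|m IHm] a ha; have [a_lt0|a_ge0] := ltP a 0.
- by have -> : a = -1 by lia.
- rewrite /= ltNge a_ge0 /=; lia.
- have -> : a = -1 by lia.
  by rewrite (line_walksN m.+1 1).
rewrite /= ltNge a_ge0 /= -(IHm (a - 1)); last lia.
rewrite -(IHm (a + 1)); last lia.
rewrite (_ : a - 1 + 2 = a + 1); last lia.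
rewrite (_ : a + 2 - 1 = a + 1); last lia.
rewrite (_ : a + 1 + 2 = a + 2 + 1); last lia.
by rewrite addnACA addnA.
Qed.

Lemma catalan_bin n : (catalan n + 'C(2 * n, n.+1))%N = 'C(2 * n, n).
Proof.
have h : (n.+1 * 'C(2 * n, n.+1) = n * 'C(2 * n, n))%N.
  by rewrite mul_bin_left mul2n -addnn addnK.
apply/eqP; rewrite -(eqn_pmul2r (ltn0Sn n)) mulnDl catalanK.
by rewrite [('C(_, n.+1) * _)%N]mulnC h -mulSn mulnC.
Qed.

Lemma halfline_walks_catalan n : halfline_walks (2 * n) 0 = catalan n.
Proof.
have := halfline_walks_reflection (2 * n) 0 isT.
(* Starting from -2 instead of 2 gives [k = n.+1]; the start 2 would need [k = n - 1], which is
   truncated at [n = 0]. *)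
rewrite -(line_walksN _ (0 + 2)).
rewrite (_ : - (0 + 2) = (2 * n)%N%:Z - 2 * n.+1%:Z); last lia.
rewrite line_walks_bin (_ : line_walks _ 0 = 'C(2 * n, n)).
  by rewrite -catalan_bin => /addIn.
by rewrite -line_walks_bin; congr line_walks; lia.
Qed.

Lemma big_seq_sub (T : choiceType) (S : seq T) (F : T -> nat) :
  (\sum_(s : seq_sub S) F (val s) = \sum_(s <- undup S) F s)%N.
Proof.
rewrite -(big_map val xpredT F); apply: perm_big; apply: uniq_perm.
- by rewrite map_inj_uniq ?index_enum_uniq //; exact: val_inj.
- exact: undup_uniq.
move=> s; rewrite mem_undup; apply/mapP/idP => [[t _ ->]|Ss]; first exact: valP.
by exists (SeqSub Ss); rewrite ?mem_index_enum.
Qed.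

(** Splitting a walk into its first step and the rest is a bijection. [undup] appears because
    [seq_sub S] ignores repetitions in [S]. *)
Lemma card_quadrant_walksS S m x y :
  #|quadrant_walks S m.+1 x y| =
  (if in_quadrant x then \sum_(s <- undup S) #|quadrant_walks S m (x + s)%R y|
   else 0)%N.
Proof.
rewrite -(big_seq_sub _ S (fun s => #|quadrant_walks S m (x + s) y|)).
rewrite -sum1_card.
rewrite (reindex (fun p : seq_sub S * m.-tuple (seq_sub S) =>
                    [tuple of p.1 :: p.2])) /=; last first.
  exists (fun w => (thead w, [tuple of behead w])) => [[s w] _|w _] /=.
    by congr pair; apply: val_inj.
  by rewrite [RHS]tuple_eta.
under eq_bigl => p do rewrite inE /= -andbA.
case: (in_quadrant x) => /=; last by rewrite big_pred0.
under [RHS]eq_bigr => s _ do rewrite -sum1_card.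
by rewrite pair_big_dep; apply: eq_bigl => -[s w]; rewrite inE.
Qed.

(** The diagonal steps are all pairs of signs, so the sum over first steps factors into one sum per
    coordinate. *)
Lemma card_diagonal_quadrant_walks m a b :
  #|quadrant_walks diagonal_steps m (a, b) (0, 0)|
  = (halfline_walks m a * halfline_walks m b)%N.
Proof.
elim: m a b => [|m IHm] a b.
  rewrite -sum1_card (eq_bigl (fun=> (a == 0) && (b == 0))); last first.
    move=> w; rewrite inE tuple0 /= /in_quadrant /= xpair_eqE.
    by case: eqP => [->|_]; case: eqP => [->|_]; rewrite ?andbF.
  rewrite sum_nat_const /=.
  case: (eqVneq a 0) => [->|_]; last by rewrite /= if_same mul0n eq_card0.
  case: (eqVneq b 0) => [->|_]; last by rewrite /= if_same muln0 eq_card0.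
  by rewrite eq_cardT // -cardT card_tuple.
rewrite card_quadrant_walksS /in_quadrant /= !leNgt.
case: (a < 0) => //=; case: (b < 0) => /=; first by rewrite muln0.
by rewrite !big_cons big_nil !IHm addn0 mulnDl !mulnDr !addnA.
Qed.

(* Any way of splitting the four arguments into two pairs would do; this one
   makes the top entries of the last two binomials independent of [k] in each
   of the three sums. *)
Lemma multinomial4_bin p q r s :
  multinomial4 p q r s
  = ('C(p + q + r + s, p + s) * ('C(p + s, p) * 'C(q + r, r)))%N.
Proof.
have bin_factD i j : ('C(i + j, i) * (i`! * j`!) = (i + j)`!)%N.
  by have := bin_fact (leq_addr j i); rewrite addKn.
have fact_pos : (0 < p`! * q`! * r`! * s`!)%N by rewrite !muln_gt0 !fact_gt0.
apply/eqP; rewrite -(eqn_pmul2r fact_pos) multinomial4K.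
rewrite (_ : p + q + r + s = p + s + (r + q))%N; last lia.
by rewrite -bin_factD -(bin_factD p) -(bin_factD r) (addnC q); apply/eqP; ring.
Qed.

(** With lower index [n], Vandermonde's sum has the range [k < n.+1] of the two shifted multinomial
    sums. *)
Lemma bin_central_sym n : 'C(2 * n.+1, n) = 'C(2 * n.+1, n.+2).
Proof. by rewrite -bin_sub; [congr 'C(_, _)|]; lia. Qed.

Lemma sum_multinomial4_central n :
  (\sum_(0 <= k < n.+1) multinomial4 k k (n - k) (n - k) = 'C(2 * n, n) ^ 2)%N.
Proof.
rewrite expnS expn1 {2}mul2n -addnn -binomial.Vandermonde.
rewrite big_mkord big_distrr /=.
apply: eq_bigr => -[k hk] _ /=; rewrite multinomial4_bin.
by congr ('C(_, _) * ('C(_, _) * 'C(_, _)))%N; lia.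
Qed.

Lemma sum_multinomial4_shift2 n :
  (\sum_(0 <= k < n) multinomial4 k (k + 2) (n - k - 1) (n - k - 1)
   = 'C(2 * n, n.+1) ^ 2)%N.
Proof.
case: n => [|n]; first by rewrite big_nil.
rewrite -bin_central_sym expnS expn1.
rewrite {2}(_ : 2 * n.+1 = n + n.+2)%N; last lia.
rewrite -binomial.Vandermonde big_mkord big_distrr /=.
apply: eq_bigr => -[k hk] _ /=; rewrite multinomial4_bin.
by congr ('C(_, _) * ('C(_, _) * 'C(_, _)))%N; lia.
Qed.

Lemma sum_multinomial4_shift1 n :
  (\sum_(0 <= k < n) multinomial4 k (k + 1) (n - k - 1) (n - k)
   = 'C(2 * n, n) * 'C(2 * n, n.+1))%N.
Proof.
case: n => [|n]; first by rewrite big_nil.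
rewrite -bin_central_sym {2}mul2n -addnn -binomial.Vandermonde.
rewrite big_mkord big_distrr /=.
apply: eq_bigr => -[k hk] _ /=; rewrite multinomial4_bin.
by congr ('C(_, _) * ('C(_, _) * 'C(_, _)))%N; lia.
Qed.

Theorem mainTheorem5 (n : nat) :
  #|quadrant_walks diagonal_steps (2 * n) (0, 0) (0, 0)| = (catalan n ^ 2)%N
  /\ ((catalan n)%:Z ^+ 2 =
       \sum_(0 <= k < n.+1) (multinomial4 k k (n - k) (n - k))%:Z
       + \sum_(0 <= k < n) (multinomial4 k (k + 2) (n - k - 1) (n - k - 1))%:Z
       - 2%:Z * \sum_(0 <= k < n) (multinomial4 k (k + 1) (n - k - 1) (n - k))%:Z).
Proof.
split; first by rewrite card_diagonal_quadrant_walks halfline_walks_catalan.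
rewrite -!(big_morph Posz PoszD (erefl _)) sum_multinomial4_central.
(* With [B = 'C(2 * n, n.+1)] and [c = catalan n], what remains is
   [c^2 = (c + B)^2 + B^2 - 2 (c + B) B]. *)
rewrite sum_multinomial4_shift2 sum_multinomial4_shift1 -catalan_bin.
ring.
Qed.
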